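(* Let $\mathbf{K}_1=\{x\in\mathbb{R}^{n_1}:g_j(x)\ge0,\ j=1,\ldots,m_1\}$ and $\mathbf{K}_2=\{z\in\mathbb{R}^{n_2}:h_k(z)\ge0,\ k=1,\ldots,m_2\}$ be nonempty compact basic semi-algebraic sets, and let $p\in\mathbb{R}[x,z]$. Consider the zero-sum game with value $$J^*=\min_{\mu\in P(\mathbf{K}_1)}\max_{\nu\in P(\mathbf{K}_2)}\int_{\mathbf{K}_2}\int_{\mathbf{K}_1}p(x,z)\,d\mu(x)\,d\nu(z),$$ where $P(\mathbf{K}_i)$ is the set of Borel probability measures on $\mathbf{K}_i$. Let $(\mathrm{A}_d)$, $(\mathrm{B}_t)$, $r_j$, $l_k$ be as defined in the context. Let $\lambda_d^*$ be the optimal value of $(\mathrm{A}_d)$ and suppose that, with $r:=\max_{j=1,\ldots,m_1}r_j$, the condition $$\operatorname{rank}M_{d-r}(\mathbf{y})=\operatorname{rank}M_d(\mathbf{y})\ (=:s_1)$$ holds at an optimal solution $(\mathbf{y},\lambda,\sigma_k)$ of $(\mathrm{A}_d)$. Let $\gamma_t^*$ be the optimal value of $(\mathrm{B}_t)$ and suppose that, with $r':=\max_{k=1,\ldots,m_2}l_k$, the condition $$\operatorname{rank}M_{t-r'}(\mathbf{y}')=\operatorname{rank}M_t(\mathbf{y}')\ (=:s_2)$$ holds at an optimal solution $(\mathbf{y}',\gamma,\sigma_j)$ of $(\mathrm{B}_t)$. If $\lambda_d^*=\gamma_t^*$, then $\lambda_d^*=\gamma_t^*=J^*$, and there is an optimal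 strategy $\mu^*$ for player 1 that is a probability measure supported on $s_1$ points of $\mathbf{K}_1$ and an optimal strategy $\nu^*$ for player 2 that is a probability measure supported on $s_2$ points of $\mathbf{K}_2$.
   Context: Optimal strategies: for compact $\mathbf{K}_1,\mathbf{K}_2$ the min-max value $J^*$ equals the max-min value $\max_{\nu\in P(\mathbf{K}_2)}\min_{\mu\in P(\mathbf{K}_1)}\int\int p\,d\mu\,d\nu$. Player 1 (the minimizer) chooses $\mu\in P(\mathbf{K}_1)$ and player 2 (the maximizer) chooses $\nu\in P(\mathbf{K}_2)$; $\mu^*$ is optimal for player 1 if it attains the outer minimum in the min-max problem, and $\nu^*$ is optimal for player 2 if it attains the outer maximum in the max-min problem. $\Sigma[\cdot]$ denotes the cone of sums of squares of polynomials. For a real sequence $\mathbf{y}=(y_\alpha)$ indexed by monomials of degree at most $2d$, $L_{\mathbf{y}}(\sum_\alpha f_\alpha x^\alpha):=\sum_\alpha f_\alpha y_\alpha$; the moment matrix $M_s(\mathbf{y})$ has entries $y_{\alpha+\beta}$, $|\alpha|,|\beta|\le s$, and the localizing matrix $M_s(\theta,\mathbf{y})$ has entries $L_{\mathbf{y}}(x^{\alpha+\beta}\theta)$, $|\alpha|,|\beta|\le s$. $A\succeq0$ means positive semidefinite. Write $p(x,z)=\sum_{\alpha\in\mathbb{N}^{n_2}}\sum_{\beta\in\mathbb{N}^{n_1}}p_{\alpha\beta}\,x^\beta z^\alpha$ and also $p(x,z)=\sum_{\alpha\in\mathbb{N}^{n_1}}\sum_{\beta\in\mathbb{N}^{n_2}}\hat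 p_{\alpha\beta}\,z^\beta x^\alpha$. For $\mathbf{y}$ indexed by monomials in $x$, set $p_{\mathbf{y}}(z):=\sum_\alpha\big(\sum_\beta p_{\alpha\beta}y_\beta\big)z^\alpha$; for $\mathbf{y}$ indexed by monomials in $z$, set $\hat p_{\mathbf{y}}(x):=\sum_\alpha\big(\sum_\beta\hat p_{\alpha\beta}y_\beta\big)x^\alpha$. Let $r_j:=\lceil\deg g_j/2\rceil$, $l_k:=\lceil\deg h_k/2\rceil$, $g_0\equiv1$, $h_0\equiv1$. The programs are considered for $d$ (resp. $t$) large enough that all the quantities below make sense. $(\mathrm{A}_d)$: minimize $\lambda$ over $\lambda\in\mathbb{R}$, $\mathbf{y}$ (indexed by monomials of $\mathbb{R}[x]_{2d}$) and $\sigma_k\in\Sigma[z]$, subject to: $\lambda-p_{\mathbf{y}}=\sum_{k=0}^{m_2}\sigma_kh_k$ (equality of polynomials in $z$); $M_d(\mathbf{y})\succeq0$; $M_{d-r_j}(g_j,\mathbf{y})\succeq0$, $j=1,\ldots,m_1$; $y_0=1$; $\deg\sigma_k+\deg h_k\le2d$, $k=0,\ldots,m_2$. $(\mathrm{B}_t)$: maximize $\gamma$ over $\gamma\in\mathbb{R}$, $\mathbf{y}$ (indexed by monomials of $\mathbb{R}[z]_{2t}$) and $\sigma_j\in\Sigma[x]$, subject to: $\hat p_{\mathbf{y}}-\gamma=\sum_{j=0}^{m_1}\sigma_jg_j$ (equality of polynomials in $x$); $M_t(\mathbf{y})\succeq0$; $M_{t-l_k}(h_k,\mathbf{y})\succeq0$,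 $k=1,\ldots,m_2$; $y_0=1$; $\deg\sigma_j+\deg g_j\le2t$, $j=0,\ldots,m_1$. *)

(* Defs.v *)
From HB Require Import structures.
From mathcomp Require Import all_boot all_order all_algebra.
From mathcomp Require Import all_classical all_reals all_analysis.
(* The notations of mpoly clash with those of mathcomp-analysis.  Without them
   [mpoly n R] is {mpoly R[n]}, [multinom n] is 'X_{1..n}, [bmultinom n b] is
   'X_{1..n < b}, [mcoeff m f] is f@_m, [mpolyX R m] is 'X_[m], [mpolyC n c] is
   c%:MP and [meval v f] is f.@[v]. *)
From mathcomp Require Import -(notations) mpoly.

Set Implicit Arguments.
Unset Strict Implicit.
Unset Printing Implicit Defensive.

Import Order.TTheory GRing.Theory Num.Theory.
Import numFieldNormedType.Exports.

Local Open Scope classical_set_scope.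
Local Open Scope ring_scope.

(** * Polynomials *)

(* The zero polynomial gets degree 0. *)
Definition deg (R : realType) (n : nat) (f : mpoly n R) : nat :=
  (mmeasure (@mdeg n) f).-1.

(* ceil (deg f / 2) *)
Definition half_deg (R : realType) (n : nat) (f : mpoly n R) : nat :=
  uphalf (deg f).

Definition max_half_deg (R : realType) (n m : nat) (g : 'I_m -> mpoly n R) : nat :=
  (\max_(j < m) half_deg (g j))%N.

Definition sos (R : realType) (n : nat) (f : mpoly n R) : Prop :=
  exists s : seq (mpoly n R), f = \sum_(q <- s) q ^+ 2.

(* The family g_1, ..., g_m preceded by g_0 = 1. *)
Definition with1 (R : realType) (n m : nat) (g : 'I_m -> mpoly n R)
    (j : 'I_m.+1) : mpoly n R :=
  if unlift ord0 j is Some i then g i else 1.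

Definition eval (R : realType) (n : nat) (f : mpoly n R) (x : 'rV[R]_n) : R :=
  meval (fun i => x ord0 i) f.

Definition semialg (R : realType) (n m : nat) (g : 'I_m -> mpoly n R) : set 'rV[R]_n :=
  [set x | forall j, 0 <= eval (g j) x].

(* An element p of R[x, z] is a polynomial in n1 + n2 variables, the first n1
   of which are x. *)
Definition xpart (n1 n2 : nat) (m : multinom (n1 + n2)) : multinom n1 :=
  Multinom [tuple m (lshift n2 i) | i < n1].

Definition zpart (n1 n2 : nat) (m : multinom (n1 + n2)) : multinom n2 :=
  Multinom [tuple m (rshift n1 i) | i < n2].

Definition deg_x (R : realType) (n1 n2 : nat) (p : mpoly (n1 + n2) R) : nat :=
  (\max_(m <- msupp p) mdeg (xpart m))%N.

Definition deg_z (R : realType) (n1 n2 : nat) (p : mpoly (n1 + n2) R) : nat :=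
  (\max_(m <- msupp p) mdeg (zpart m))%N.

(** * Moment and localizing matrices *)

(* A sequence indexed by the monomials of degree at most D. *)
Definition mseq (R : realType) (n D : nat) : Type := bmultinom n D.+1 -> R.

(* The entry y_m, and 0 if the degree of m exceeds D. *)
Definition mom (R : realType) (n D : nat) (y : mseq R n D) (m : multinom n) : R :=
  oapp y 0 (insub m).

Definition Lfun (R : realType) (n D : nat) (y : mseq R n D) (f : mpoly n R) : R :=
  \sum_(m <- msupp f) mcoeff m f * mom y m.

Definition moment_mx (R : realType) (n D s : nat) (y : mseq R n D)
    : 'M[R]_#|{: bmultinom n s.+1}| :=
  \matrix_(a, b) mom y (mnm_add (bmnm (enum_val a)) (bmnm (enum_val b))).

Definition localizing_mx (R : realType) (n D s : nat) (theta : mpoly n R)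
    (y : mseq R n D) : 'M[R]_#|{: bmultinom n s.+1}| :=
  \matrix_(a, b) Lfun y (mpolyX R (mnm_add (bmnm (enum_val a)) (bmnm (enum_val b))) * theta).

Definition psd (R : realType) (k : nat) (A : 'M[R]_k) : Prop :=
  A^T = A /\ forall v : 'cV[R]_k, 0 <= (v^T *m A *m v) ord0 ord0.

(** * The semidefinite programs *)

(* p_y, for y indexed by monomials in x. *)
Definition p_x (R : realType) (n1 n2 D : nat) (p : mpoly (n1 + n2) R)
    (y : mseq R n1 D) : mpoly n2 R :=
  \sum_(m <- msupp p) (mcoeff m p * mom y (xpart m)) *: mpolyX R (zpart m).

(* \hat p_y, for y indexed by monomials in z. *)
Definition p_z (R : realType) (n1 n2 D : nat) (p : mpoly (n1 + n2) R)
    (y : mseq R n2 D) : mpoly n1 R :=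
  \sum_(m <- msupp p) (mcoeff m p * mom y (zpart m)) *: mpolyX R (xpart m).

Definition feasibleA (R : realType) (n1 n2 m1 m2 : nat) (p : mpoly (n1 + n2) R)
    (g : 'I_m1 -> mpoly n1 R) (h : 'I_m2 -> mpoly n2 R) (d : nat)
    (lam : R) (y : mseq R n1 (2 * d)) (sigma : 'I_m2.+1 -> mpoly n2 R) : Prop :=
  [/\ mpolyC n2 lam - p_x p y = \sum_(k < m2.+1) sigma k * with1 h k,
      psd (moment_mx d y),
      forall j, psd (localizing_mx (d - half_deg (g j)) (g j) y),
      mom y (@mnm0 n1) = 1
    & forall k, sos (sigma k) /\ (deg (sigma k) + deg (with1 h k) <= 2 * d)%N].

Definition valueA (R : realType) (n1 n2 m1 m2 : nat) (p : mpoly (n1 + n2) R)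
    (g : 'I_m1 -> mpoly n1 R) (h : 'I_m2 -> mpoly n2 R) (d : nat) : \bar R :=
  ereal_inf [set lam%:E | lam in
    [set lam | exists y sigma, @feasibleA R n1 n2 m1 m2 p g h d lam y sigma]].

Definition optimalA (R : realType) (n1 n2 m1 m2 : nat) (p : mpoly (n1 + n2) R)
    (g : 'I_m1 -> mpoly n1 R) (h : 'I_m2 -> mpoly n2 R) (d : nat)
    (lam : R) (y : mseq R n1 (2 * d)) (sigma : 'I_m2.+1 -> mpoly n2 R) : Prop :=
  feasibleA p g h lam y sigma /\ lam%:E = valueA p g h d.

Definition feasibleB (R : realType) (n1 n2 m1 m2 : nat) (p : mpoly (n1 + n2) R)
    (g : 'I_m1 -> mpoly n1 R) (h : 'I_m2 -> mpoly n2 R) (t : nat)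
    (gam : R) (y : mseq R n2 (2 * t)) (sigma : 'I_m1.+1 -> mpoly n1 R) : Prop :=
  [/\ p_z p y - mpolyC n1 gam = \sum_(j < m1.+1) sigma j * with1 g j,
      psd (moment_mx t y),
      forall k, psd (localizing_mx (t - half_deg (h k)) (h k) y),
      mom y (@mnm0 n2) = 1
    & forall j, sos (sigma j) /\ (deg (sigma j) + deg (with1 g j) <= 2 * t)%N].

Definition valueB (R : realType) (n1 n2 m1 m2 : nat) (p : mpoly (n1 + n2) R)
    (g : 'I_m1 -> mpoly n1 R) (h : 'I_m2 -> mpoly n2 R) (t : nat) : \bar R :=
  ereal_sup [set gam%:E | gam in
    [set gam | exists y sigma, @feasibleB R n1 n2 m1 m2 p g h t gam y sigma]].

Definition optimalB (R : realType) (n1 n2 m1 m2 : nat) (p : mpoly (n1 + n2) R)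
    (g : 'I_m1 -> mpoly n1 R) (h : 'I_m2 -> mpoly n2 R) (t : nat)
    (gam : R) (y : mseq R n2 (2 * t)) (sigma : 'I_m1.+1 -> mpoly n1 R) : Prop :=
  feasibleB p g h gam y sigma /\ gam%:E = valueB p g h t.

(** * The game *)

(* R^n with its Borel sigma-algebra. *)
Definition borel (R : realType) (n : nat) := g_sigma_algebraType (@open 'rV[R]_n).

(* Borel probability measures on a Borel set K, seen as measures on R^n giving
   mass 1 to K. *)
Definition prob_on (R : realType) (n : nat) (K : set 'rV[R]_n)
    : set (probability (borel R n) R) :=
  [set mu | mu K = 1%E].

Definition payoff (R : realType) (n1 n2 : nat) (p : mpoly (n1 + n2) R)
    (K1 : set 'rV[R]_n1) (K2 : set 'rV[R]_n2)
    (mu : probability (borel R n1) R) (nu : probability (borel R n2) R) : \bar R :=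
  (\int[nu]_(z in K2) \int[mu]_(x in K1) (eval p (row_mx x z))%:E)%E.

Definition is_max (R : realType) (A : set \bar R) (v : \bar R) : Prop :=
  A v /\ ubound A v.

Definition is_min (R : realType) (A : set \bar R) (v : \bar R) : Prop :=
  A v /\ lbound A v.

(* v = max_{nu in P(K2)} payoff mu nu *)
Definition inner_max (R : realType) (n1 n2 : nat) (p : mpoly (n1 + n2) R)
    (K1 : set 'rV[R]_n1) (K2 : set 'rV[R]_n2)
    (mu : probability (borel R n1) R) (v : \bar R) : Prop :=
  is_max [set payoff p K1 K2 mu nu | nu in prob_on K2] v.

(* v = min_{mu in P(K1)} payoff mu nu *)
Definition inner_min (R : realType) (n1 n2 : nat) (p : mpoly (n1 + n2) R)
    (K1 : set 'rV[R]_n1) (K2 : set 'rV[R]_n2)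
    (nu : probability (borel R n2) R) (v : \bar R) : Prop :=
  is_min [set payoff p K1 K2 mu nu | mu in prob_on K1] v.

(* J = min_{mu in P(K1)} max_{nu in P(K2)} payoff mu nu; all the extrema are
   required to be attained. *)
Definition minmax_value (R : realType) (n1 n2 : nat) (p : mpoly (n1 + n2) R)
    (K1 : set 'rV[R]_n1) (K2 : set 'rV[R]_n2) (J : \bar R) : Prop :=
  (forall mu, prob_on K1 mu -> exists v, inner_max p K1 K2 mu v) /\
  is_min [set v | exists2 mu, prob_on K1 mu & inner_max p K1 K2 mu v] J.

(* J = max_{nu in P(K2)} min_{mu in P(K1)} payoff mu nu, likewise. *)
Definition maxmin_value (R : realType) (n1 n2 : nat) (p : mpoly (n1 + n2) R)
    (K1 : set 'rV[R]_n1) (K2 : set 'rV[R]_n2) (J : \bar R) : Prop :=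
  (forall nu, prob_on K2 nu -> exists v, inner_min p K1 K2 nu v) /\
  is_max [set v | exists2 nu, prob_on K2 nu & inner_min p K1 K2 nu v] J.

Definition optimal_strategy1 (R : realType) (n1 n2 : nat) (p : mpoly (n1 + n2) R)
    (K1 : set 'rV[R]_n1) (K2 : set 'rV[R]_n2)
    (mu : probability (borel R n1) R) : Prop :=
  prob_on K1 mu /\
  exists2 J, minmax_value p K1 K2 J & inner_max p K1 K2 mu J.

Definition optimal_strategy2 (R : realType) (n1 n2 : nat) (p : mpoly (n1 + n2) R)
    (K1 : set 'rV[R]_n1) (K2 : set 'rV[R]_n2)
    (nu : probability (borel R n2) R) : Prop :=
  prob_on K2 nu /\
  exists2 J, maxmin_value p K1 K2 J & inner_min p K1 K2 nu J.

(* The support of mu consists of exactly s distinct points, all in K. *)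
Definition supported_on (R : realType) (n : nat) (K : set 'rV[R]_n) (s : nat)
    (mu : probability (borel R n) R) : Prop :=
  exists a : 'I_s -> 'rV[R]_n,
    [/\ injective a,
        forall i, K (a i),
        forall i, (0 < mu [set a i])%E
      & mu (range a) = 1%E].

(* Main.v *)
(* The moment matrix of an optimal y has the form B^T G B with G positive
   definite of size s, its rank, so each monomial becomes a vector of R^s.
   Flatness makes multiplication by the i-th variable a well-defined
   G-self-adjoint matrix of size s, and these matrices commute.  A joint
   eigenbasis yields s atoms representing y, whose coordinates are the
   eigenvalues.  Polynomials of degree at most d - r interpolate at the atoms,
   so the localizing matrices force the atoms into K.  The two sum-of-squares
   certificates then bound the payoff of the two atomic measures from above and
   below by the common optimal value: they form a saddle point. *)

Require Import Defs.
From HB Require Import structures.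
From mathcomp Require Import all_boot all_order all_algebra.
From mathcomp Require Import all_classical all_reals all_analysis.
From mathcomp Require Import -(notations) mpoly.
From mathcomp Require Import measurable_realfun complex ring lra zify.

Set Implicit Arguments.
Unset Strict Implicit.
Unset Printing Implicit Defensive.

Import Order.TTheory GRing.Theory Num.Theory.
Import numFieldNormedType.Exports.

Local Open Scope classical_set_scope.
Local Open Scope ring_scope.

(* [eval] and [Lfun] are shadowed by names of mathcomp-analysis. *)
Local Notation eval := Defs.eval.
Local Notation Lfun := Defs.Lfun.

(** * Self-adjoint matrices for a definite form *)

Definition posdef (R : realType) (s : nat) (G : 'M[R]_s) : Prop :=
  forall u : 'cV[R]_s, u != 0 -> 0 < (u^T *m G *m u) ord0 ord0.

(** For any [w], the form at [w + c *: u] is affine in [c] with slope twice [w^T G u], so it stays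
    nonnegative only if that slope vanishes. *)
Lemma psd_isotropic (R : realType) (s : nat) (G : 'M[R]_s) (u : 'cV[R]_s) :
  psd G -> (u^T *m G *m u) ord0 ord0 = 0 -> G *m u = 0.
Proof.
move=> [Gsym Gpsd] uGu.
suff b0 (w : 'cV_s) : (w^T *m G *m u) ord0 ord0 = 0.
  apply/colP => i; rewrite [RHS]mxE -(b0 (delta_mx i ord0)).
  by rewrite trmx_delta -mulmxA -rowE [RHS]mxE.
set b := _ ord0 ord0; apply/eqP; apply: contraT => b_neq0.
set a := (w^T *m G *m w) ord0 ord0.
have sym : (u^T *m G *m w) ord0 ord0 = b.
  rewrite /b -[w^T *m G *m u]trmxK [RHS]mxE.
  by rewrite !trmx_mul trmxK Gsym mulmxA.
have expand c : ((w + c *: u)^T *m G *m (w + c *: u)) ord0 ord0 = a + 2 * c * b.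
  rewrite [(w + _)^T]linearD /= [(c *: u)^T]linearZ /= !mulmxDl !mulmxDr -!scalemxAl -!scalemxAr.
  move: uGu sym; rewrite /a /b !mxE => -> ->.
  by rewrite -/b; ring.
(* This value of [c] brings the form down to -1. *)
have := Gpsd (w + (- (a + 1) / (2 * b)) *: u); rewrite expand.
rewrite (_ : a + _ = -1); first by rewrite oppr_ge0 ler10.
by field.
Qed.

(** [B] is a basis of the row space of [M], with right inverse [Q], and [G := Q^T M Q]. It is
    semidefinite of full rank, which [psd_isotropic] turns into definiteness. *)
Lemma psd_factor (R : realType) (N : nat) (M : 'M[R]_N) : psd M ->
  exists (B : 'M[R]_(\rank M, N)) (G : 'M[R]_(\rank M)),
    [/\ M = B^T *m G *m B, G^T = G & posdef G].
Proof.
move=> [Msym Mpsd]; pose B := row_base M.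
have /row_freeP[Q BQ] : row_free B by exact: row_base_free.
have [A MA] : exists A, M = A *m B.
  by apply/submxP; rewrite /B eq_row_base.
have MQB : M *m Q *m B = M.
  have : A *m B *m Q *m B = A *m B by rewrite -(mulmxA A) BQ mulmx1.
  by rewrite -MA.
have BQM : B^T *m Q^T *m M = M.
  by apply: trmx_inj; rewrite !trmx_mul !trmxK Msym mulmxA.
pose G := Q^T *m M *m Q.
have Gsym : G^T = G by rewrite !trmx_mul trmxK Msym mulmxA.
have Mfac : M = B^T *m G *m B .
  have -> : B^T *m G *m B = B^T *m Q^T *m M *m Q *m B by rewrite /G !mulmxA.
  by rewrite BQM MQB.
have Gpsd : psd G.
  split=> // v; have := Mpsd (Q *m v).
  by rewrite trmx_mul !mulmxA.
exists B, G; split=> // u u0; rewrite lt_def (proj2 Gpsd) andbT.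
apply: contra u0 => /eqP /(psd_isotropic Gpsd) Gu.
have Gunit : G \in unitmx.
  rewrite -row_free_unit /row_free eqn_leq rank_leq_row /=.
  have : (\rank (B^T *m (G *m B)) <= \rank G)%N.
    exact: leq_trans (mxrankM_maxr _ _) (mxrankM_maxl _ _).
  by rewrite mulmxA -Mfac.
by apply/eqP; rewrite -[u](mulKmx Gunit) Gu mulmx0.
Qed.

Section SelfAdjoint.
Variables (R : realType) (s : nat) (G X : 'M[R]_s.+1).
Hypotheses (Gpos : posdef G) (GX : G *m X = X^T *m G).

Lemma posdef_eq0 (u : 'cV[R]_s.+1) : (u^T *m G *m u) ord0 ord0 = 0 -> u = 0.
Proof.
by move=> uGu; apply/eqP; apply: contraT => /Gpos; rewrite uGu ltxx.
Qed.

Lemma selfadj_shift (a : R) : G *m (X - a%:M) = (X - a%:M)^T *m G.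
Proof.
by rewrite [(X - _)^T]linearB /= tr_scalar_mx mulmxBl mulmxBr GX mul_scalar_mx mul_mx_scalar.
Qed.

(** With [Y := X - a] self-adjoint for [G], the squared [G]-norm of [Y z] is [z^T G (Y Y z)]. This
    excludes nontrivial Jordan blocks. *)
Lemma selfadj_sqr_eq0 (a : R) (Z : 'M[R]_s.+1) :
  (X - a%:M) *m ((X - a%:M) *m Z) = 0 -> (X - a%:M) *m Z = 0.
Proof.
set Y := X - a%:M => YYZ; apply/matrixP => i j.
suff : col j (Y *m Z) = 0 by move=> /matrixP/(_ i ord0); rewrite !mxE.
apply: posdef_eq0.
have -> : col j (Y *m Z) = Y *m (Z *m delta_mx j ord0) by rewrite mulmxA -colE.
set w := Z *m _; rewrite trmx_mul -(mulmxA w^T) -selfadj_shift -!mulmxA.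
by rewrite /w !mulmxA -(mulmxA _ Y Y) -(mulmxA _ _ Z) -(mulmxA Y Y) YYZ mulmx0 mul0mx mxE.
Qed.

(** With [Y := X - a] and [u] in the kernel, pairing with [u] gives [|Y u|^2 + b^2 |u|^2 = 0] in the
    [G]-norm, so [u = 0]. *)
Lemma selfadj_quad_unit (a b : R) : b != 0 ->
  (X - a%:M) *m (X - a%:M) + (b ^+ 2)%:M \in unitmx.
Proof.
move=> b0; rewrite -row_free_unit /row_free -mxrank_tr -/(row_free _).
set Y := X - a%:M; rewrite -kermx_eq0; apply/eqP/row_matrixP => i.
rewrite row0; set v := row i _.
have /(congr1 trmx) : v *m (Y *m Y + (b ^+ 2)%:M)^T = 0.
  by apply/sub_kermxP; rewrite row_sub.
rewrite trmx_mul trmxK trmx0 mulmxDl mul_scalar_mx => Yv.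
suff : v^T = 0 by move=> /(congr1 trmx); rewrite trmxK trmx0.
set u := v^T in Yv *; apply/eqP; apply: contraT => u0.
have: (u^T *m G *m (Y *m Y *m u + b ^+ 2 *: u)) ord0 ord0 = 0.
  by rewrite Yv mulmx0 mxE.
have -> : u^T *m G *m (Y *m Y *m u + b ^+ 2 *: u) =
    (Y *m u)^T *m G *m (Y *m u) + b ^+ 2 *: (u^T *m G *m u).
  rewrite mulmxDr -scalemxAr trmx_mul; congr (_ + _).
  by rewrite -(mulmxA u^T _ G) -selfadj_shift !mulmxA.
rewrite mxE [X in _ + X]mxE => /eqP.
have b2 : 0 < b ^+ 2 by rewrite exprn_even_gt0.
rewrite gt_eqF // ltr_wpDl ?(mulr_gt0 b2) ?Gpos //.
by have [->|/Gpos/ltW //] := eqVneq (Y *m u) 0; rewrite mulmx0 mxE.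
Qed.

(* Nonreal roots contribute factors [(X - a)^2 + b^2], which are invertible
   at a self-adjoint matrix. *)
Lemma selfadj_split (f : {poly R}) : f != 0 ->
  exists (u : {poly R}) (rs : seq R),
    f = u * \prod_(r <- rs) ('X - r%:P) /\ horner_mx X u \in unitmx.
Proof.
have [k] := ubnP (size f); elim: k f => // k IH f; rewrite ltnS => fk f0.
have [f1|f1] := leqP (size f) 1.
  exists f, [::]; rewrite big_nil mulr1; split=> //.
  rewrite (size1_polyC f1) horner_mx_C unitmxE det_scalar unitrX // unitfE.
  by move: f0; rewrite {1}(size1_polyC f1) polyC_eq0.
have [z] : exists z : complex R, root (map_poly (real_complex R) f) z.
  by apply: closed_rootP; rewrite size_map_poly gtn_eqF.
case: z => a b; have [->|b0] := eqVneq b 0.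
  rewrite (_ : Complex a 0 = real_complex R a) // fmorph_root => /factor_theorem[q fq].
  have q0 : q != 0 by apply: contra f0 => /eqP q0; rewrite fq q0 mul0r.
  have [|u [rs [qE uU]]] := IH q _ q0.
    by rewrite (leq_trans _ fk) // fq size_Mmonic ?monicXsubC // size_XsubC addn2.
  exists u, (a :: rs); split=> //.
  by rewrite big_cons fq qE [X in _ = u * X]mulrC mulrA.
set z := Complex a b => fz.
pose Q : {poly R} := ('X - a%:P) ^+ 2 + (b ^+ 2)%:P.
have Qsz : size Q = 3.
  by rewrite size_polyDl size_exp_XsubC // (leq_ltn_trans (size_polyC_leq1 _)).
have Q0 : Q != 0 by rewrite -size_poly_gt0 Qsz.
have Qz : root (map_poly (real_complex R) Q) z.
  rewrite /root /Q rmorphD rmorphXn rmorphB /= map_polyX !map_polyC /=.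
  rewrite !hornerE /z /=; apply/eqP.
  have -> : Complex a b - real_complex R a = Complex 0 b by congr Complex; ring.
  by rewrite expr2; congr Complex => /=; ring.
(* The remainder is real of degree at most 1 and vanishes at the nonreal [z]: the imaginary part
   kills its slope, then the real part its constant term. *)
have Qf : f %% Q = 0.
  set r := f %% Q; have rz : root (map_poly (real_complex R) r) z.
    rewrite /root; have := divp_eq f Q => /(congr1 (fun p => (map_poly (real_complex R) p).[z])).
    rewrite rmorphD rmorphM hornerD hornerM (eqP fz) (eqP Qz) mulr0 add0r => <-.
    by [].
  have rsz : (size r <= 2)%N by rewrite -ltnS (leq_trans (ltn_modpN0 f Q0)) // Qsz.
  have rE : r = (r`_0)%:P + (r`_1) *: 'X.
    apply/polyP => -[|[|i]]; rewrite coefD coefC coefZ coefX /= ?mulr0 ?addr0 ?mulr1 ?add0r //.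
    by rewrite nth_default // (leq_trans rsz).
  move: rz; rewrite /root rE rmorphD /= map_polyC map_polyZ map_polyX !hornerE.
  move=> /eqP; rewrite /z => -[] /= h1 h2.
  have r1 : r`_1 = 0.
    by apply/eqP; move/eqP: h2; rewrite mul0r addr0 add0r mulf_eq0 (negPf b0) orbF.
  have r0 : r`_0 = 0 by move: h1; rewrite r1; lra.
  by rewrite r0 r1 scale0r addr0.
pose q := f %/ Q; have fq : f = q * Q by rewrite {1}(divp_eq f Q) Qf addr0.
have q0 : q != 0 by apply: contra f0 => /eqP q0; rewrite fq q0 mul0r.
have [|u [rs [qE uU]]] := IH q _ q0.
  rewrite (leq_trans _ fk) // fq size_mul // Qsz addn3 /=.
  by rewrite ltnS leqW.
exists (u * Q), rs; split; first by rewrite fq qE mulrAC.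
rewrite rmorphM /= unitmx_mul uU /=.
rewrite rmorphD rmorphXn rmorphB /= horner_mx_X !horner_mx_C expr2.
exact: selfadj_quad_unit.
Qed.

(** A root that occurs again contributes a square, which [selfadj_sqr_eq0] reduces to the first
    power. The cofactor [f] is arbitrary because the induction moves the current factor into it. *)
Lemma selfadj_undup (rs : seq R) (f : {poly R}) :
  horner_mx X ((\prod_(r <- rs) ('X - r%:P)) * f) = 0 ->
  horner_mx X ((\prod_(r <- undup rs) ('X - r%:P)) * f) = 0.
Proof.
elim: rs f => [//|r rs IH] f; rewrite big_cons -mulrA mulrCA => /IH /=.
case: ifPn => [rrs|rrs]; last by rewrite big_cons mulrCA mulrA.
rewrite (big_rem r) ?mem_undup //=; set p := \prod_(_ <- _) _ => h.
rewrite -mulrA rmorphM rmorphB /= horner_mx_X horner_mx_C.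
apply: selfadj_sqr_eq0; rewrite -h.
have -> : ('X - r%:P) * p * (('X - r%:P) * f) = ('X - r%:P) * (('X - r%:P) * (p * f)).
  by ring.
by rewrite !(rmorphM, rmorphB) /= horner_mx_X horner_mx_C.
Qed.

(** Cayley-Hamilton, after cancelling the invertible factor and the repeated roots, shows that the
    minimal polynomial divides a product of distinct linear factors. *)
Lemma selfadj_diagonalizable_succ : diagonalizable X.
Proof.
have [|u [rs [cE uU]]] := @selfadj_split (char_poly X).
  by rewrite monic_neq0 // char_poly_monic.
apply/diagonalizableP; exists (undup rs); first exact: undup_uniq.
apply: mxminpoly_min; rewrite -[X in horner_mx _ X]mulr1.
apply: selfadj_undup; rewrite mulr1.
have := Cayley_Hamilton X; rewrite cE rmorphM /= => h.
by rewrite -[horner_mx X (\prod_(_ <- _) _)](mulKmx uU) [X in _ *m X]h mulmx0.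
Qed.

End SelfAdjoint.

Lemma selfadj_diagonalizable (R : realType) (s : nat) (G X : 'M[R]_s) :
  posdef G -> G *m X = X^T *m G -> diagonalizable X.
Proof.
case: s G X => [|s] G X; last exact: selfadj_diagonalizable_succ.
by rewrite (thinmx0 X) => _ _; exact: diagonalizable0.
Qed.

(** * Flat moment matrices *)

Section FlatExtension.
Variables (R : realType) (n s k d : nat) (mom : multinom n -> R).
Variables (G : 'M[R]_s) (v : multinom n -> 'cV[R]_s).

Let basis : 'I_#|{: bmultinom n k.+1}| -> multinom n := fun j => bmnm (enum_val j).
Let shifted (e : multinom n) : 'M[R]_(s, #|{: bmultinom n k.+1}|) :=
  \matrix_(i, j) v (mnm_add e (basis j)) i ord0.
Let W : 'M[R]_(s, #|{: bmultinom n k.+1}|) := \matrix_(i, j) v (basis j) i ord0.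

Hypothesis Gpos : posdef G.
Hypothesis gram : forall al be, (mdeg al <= d)%N -> (mdeg be <= d)%N ->
  ((v al)^T *m G *m v be) ord0 ord0 = mom (mnm_add al be).
(** [Wfree] encodes flatness: the vectors of the monomials of degree at most [k] already span the
    whole space of dimension [s]. *)
Hypotheses (k_le_d : (k <= d)%N) (Wfree : row_free W).
(* In zero variables the conclusion also holds for [k = d]. *)
Hypothesis k_lt_d : 'I_n -> (k < d)%N.

Let shift i := shifted (mnm1 i).

Lemma gram_entry p q (A : 'M[R]_(s, p)) (B : 'M[R]_(s, q)) a b :
  (A^T *m G *m B) a b = ((col a A)^T *m G *m col b B) ord0 ord0.
Proof.
rewrite !mxE; apply: eq_bigr => j _; rewrite !mxE; congr (_ * _).
by apply: eq_bigr => l _; rewrite !mxE.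
Qed.

Lemma posdef_unit : G \in unitmx.
Proof.
rewrite -row_free_unit /row_free -mxrank_tr -/(row_free _) -kermx_eq0.
apply/eqP/row_matrixP => i; rewrite row0; set u := row i _.
have /(congr1 trmx) : u *m G^T = 0 by apply/sub_kermxP; rewrite row_sub.
rewrite trmx_mul trmxK trmx0 => Gu.
have [/(congr1 trmx)|] := eqVneq u^T 0; first by rewrite trmxK trmx0.
by move=> /Gpos; rewrite -mulmxA Gu mulmx0 mxE ltxx.
Qed.

Lemma basis_deg j : (mdeg (basis j) <= k)%N.
Proof. by rewrite -ltnS bmdeg. Qed.

Lemma col_W j : col j W = v (basis j).
Proof. by apply/colP => i; rewrite !mxE ord1. Qed.

Lemma col_shift i j : col j (shift i) = v (mnm_add (mnm1 i) (basis j)).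
Proof. by apply/colP => l; rewrite !mxE ord1. Qed.

Lemma shift_deg (i : 'I_n) (m : multinom n) : (mdeg m <= k)%N -> (mdeg (mnm_add (mnm1 i) m) <= d)%N.
Proof. by move=> mk; rewrite mdegD mdeg1 add1n (leq_ltn_trans mk) // k_lt_d. Qed.

(** The columns of [W] span and [G] is invertible, so pairing with these columns separates
    vectors. *)
Lemma gramW_inj p (A B : 'M[R]_(s, p)) : W^T *m G *m A = W^T *m G *m B -> A = B.
Proof.
have /row_freeP[Q WQ] := Wfree => /(congr1 (mulmx (invmx G *m Q^T))).
have e (C : 'M[R]_(s, p)) : invmx G *m Q^T *m (W^T *m G *m C) = C.
  rewrite !mulmxA -(mulmxA _ Q^T) -trmx_mul WQ trmx1 mulmx1.
  by rewrite (mulVmx posdef_unit) mul1mx.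
by rewrite !e.
Qed.

Lemma sandwich_inj (A B : 'M[R]_s) : W^T *m A *m W = W^T *m B *m W -> A = B.
Proof.
have /row_freeP[Q WQ] := Wfree => /(congr1 (fun C => Q^T *m C *m Q)).
have e C : Q^T *m (W^T *m C *m W) *m Q = C.
  by rewrite -!mulmxA WQ mulmx1 mulmxA -trmx_mul WQ trmx1 mul1mx.
by rewrite !e.
Qed.

(** Hankel structure: both entries are the moment of the same product, with the variable attached to
    either factor. *)
Lemma shift_sym i : W^T *m G *m shift i = (shift i)^T *m G *m W.
Proof.
apply/matrixP => a b; rewrite gram_entry [RHS]gram_entry !col_W !col_shift.
rewrite !gram ?shift_deg ?basis_deg ?(leq_trans (basis_deg _)) //.
by congr mom; apply/mnmP => l; rewrite !mnmDE addnCA addnA.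
Qed.

Lemma shift_comm i j : (shift i)^T *m G *m shift j = (shift j)^T *m G *m shift i.
Proof.
apply/matrixP => a b; rewrite gram_entry [RHS]gram_entry !col_shift.
rewrite !gram ?shift_deg ?basis_deg //.
by congr mom; apply/mnmP => l; rewrite !mnmDE addnACA [X in (X + _)%N]addnC addnACA.
Qed.

(* [X i] is multiplication by the i-th variable on polynomials modulo the
   kernel of the moment form. *)
Lemma multiplication_matrices : exists X : 'I_n -> 'M[R]_s,
  [/\ forall i, G *m X i = (X i)^T *m G,
      forall i j, X i *m X j = X j *m X i
    & forall i m, (mdeg m < d)%N -> X i *m v m = v (mnm_add (mnm1 i) m)].
Proof.
have /row_freeP[Q WQ] := Wfree.
have [X XW] : exists X : 'I_n -> 'M[R]_s, forall i, X i *m W = shift i.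
  (* The right inverse only gives a candidate. It solves the equation because [shift_sym] moves the
     shift to the left factor, where [W Q = 1] applies. *)
  exists (fun i => shift i *m Q) => i; apply: gramW_inj.
  by rewrite !mulmxA shift_sym -(mulmxA _ W Q) WQ mulmx1.
have Xself i : G *m X i = (X i)^T *m G.
  apply: sandwich_inj.
  by rewrite -!mulmxA XW !mulmxA shift_sym -trmx_mul XW.
exists X; split=> // [i j|i m md].
- apply: gramW_inj.
  (* Self-adjointness carries the first factor to the left of [G]; [shift_comm] then exchanges the
     two. *)
  have e a b : W^T *m G *m (X a *m X b) *m W = (shift a)^T *m G *m shift b.
    rewrite -XW trmx_mul -!mulmxA XW; congr (_ *m _).
    by rewrite !mulmxA -Xself.
  have : W^T *m G *m (X i *m X j) *m W = W^T *m G *m (X j *m X i) *m W.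
    by rewrite !e shift_comm.
  by move=> /(congr1 (mulmx^~ Q)); rewrite -!mulmxA WQ !mulmx1.
(* Here [m] may have degree above [k]: self-adjointness moves the variable onto a basis monomial,
   whose degree stays at most [d]. *)
- apply: gramW_inj; rewrite mulmxA -(mulmxA W^T) Xself mulmxA -trmx_mul XW.
  apply/matrixP => a b; rewrite (gram_entry (shift i)) (gram_entry W).
  rewrite col_W col_shift !col_id.
  have md1 : (mdeg (mnm_add (mnm1 i) m) <= d)%N by rewrite mdegD mdeg1.
  rewrite (gram (shift_deg i (basis_deg a)) (ltnW md)).
  rewrite (gram (leq_trans (basis_deg a) k_le_d) md1).
  by congr mom; apply/mnmP => l; rewrite !mnmDE [in RHS]addnCA addnA.
Qed.

(** Commuting diagonalizable matrices share one [P]. The point [a l] collects the [l]-th eigenvalue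
    of every multiplication matrix. *)
Lemma joint_eigenbasis : exists (P : 'M[R]_s) (a : 'I_s -> 'rV[R]_n),
  P \in unitmx /\
  forall i, exists X : 'M[R]_s,
    [/\ G *m X = X^T *m G,
        forall m, (mdeg m < d)%N -> X *m v m = v (mnm_add (mnm1 i) m)
      & P *m X = diag_mx (\row_l a l ord0 i) *m P].
Proof.
have [X [Xself Xcomm Xv]] := multiplication_matrices.
have [] := (@codiagonalizableP _ s [seq X i | i <- enum 'I_n]).1.
  split=> [_ _ /mapP[i _ ->] /mapP[j _ ->]|_ /mapP[i _ ->]].
    exact: Xcomm.
  exact: selfadj_diagonalizable Gpos (Xself i).
move=> P Punit /allP diagP.
have /choice[D PX] : forall i, exists D : 'rV[R]_s, P *m X i = diag_mx D *m P.
  move=> i; have /diagP /similar_diagPex[D /(similarP Punit)] : X i \in [seq X i | i <- enum 'I_n].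
    by rewrite map_f ?mem_enum.
  by exists D.
exists P, (fun l => \row_i D i ord0 l); split=> // i; exists (X i); split=> [|m|]; [exact: Xself|exact: Xv|].
rewrite PX; congr (diag_mx _ *m _).
by apply/rowP => l; rewrite !mxE.
Qed.

Lemma eval_mpolyXD (m m' : multinom n) (x : 'rV[R]_n) :
  eval (mpolyX R (mnm_add m m')) x = eval (mpolyX R m) x * eval (mpolyX R m') x.
Proof. by rewrite /eval mpolyXD mevalM. Qed.

(** In the eigenbasis, coordinate [l] of [v al] is the monomial at [a l] times [c l], and the form
    becomes a diagonal matrix [T]; hence the weights [T l l * c l ^+ 2]. The bound [k.+1] on
    [mmeasure] means degree at most [k]. *)
Lemma flat_atoms : exists (a : 'I_s -> 'rV[R]_n) (w : 'I_s -> R),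
  [/\ forall l, 0 < w l,
      forall al be, (mdeg al <= d)%N -> (mdeg be <= d)%N ->
        mom (mnm_add al be) =
          \sum_l w l * eval (mpolyX R (mnm_add al be)) (a l)
    & forall l, exists2 q : mpoly n R, (mmeasure (@mdeg n) q <= k.+1)%N
        & forall l', eval q (a l') = (l' == l)%:R].
Proof.
have [P [a [Punit PX]]] := joint_eigenbasis.
pose c l := (P *m v (@mnm0 n)) l ord0.
(* Induction on the degree, splitting off one variable: [P] turns multiplication by it into scaling
   by a coordinate of [a l]. *)
have Pv al l : (mdeg al <= d)%N -> (P *m v al) l ord0 = eval (mpolyX R al) (a l) * c l.
  have [e] := ubnP (mdeg al); elim: e al => // e IH al; rewrite ltnS => ale ald.
  have [->|/eqP al0] := eqVneq al (@mnm0 n).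
    by rewrite /eval mpolyX0 meval1 mul1r.
  have [i ali] : exists i, al i != 0%N.
    apply: contrapT => /forallNP h; apply: al0; apply/mnmP => i; rewrite mnm0E.
    by have /negP := h i; rewrite negbK => /eqP.
  pose al' := mnm_sub al (mnm1 i).
  have alE : al = mnm_add (mnm1 i) al'.
    by rewrite addmC submK // lep1mP.
  have al'd : (mdeg al = (mdeg al').+1)%N by rewrite alE mdegD mdeg1.
  have [X [_ Xv PXi]] := PX i.
  rewrite alE -Xv -?al'd // mulmxA PXi -mulmxA mul_diag_mx mxE IH -?al'd //; last first.
    by rewrite ltnW // -al'd.
  by rewrite eval_mpolyXD {2}/eval mevalXU !mxE mulrA.
have /row_freeP[Q WQ] := Wfree.
pose S := invmx P.
(* Column [l] of [Q *m S] expresses the [l]-th eigenvector, column [l] of [S], through the columns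
   of [W]. *)
have interp l l' : \sum_j eval (mpolyX R (basis j)) (a l') * c l' * (Q *m S) j l = (l' == l)%:R.
  transitivity ((P *m W *m (Q *m S)) l' l).
    rewrite mxE; apply: eq_bigr => j _; congr (_ * _).
    rewrite -Pv ?(leq_trans (basis_deg j)) // -col_W.
    by rewrite colE mulmxA -colE mxE.
  by rewrite mulmxA -(mulmxA P) WQ mulmx1 mulmxV // mxE.
have c0 l : c l != 0.
  apply/eqP => cl; have := interp l l; rewrite eqxx big1 => [/eqP|j _].
    by rewrite eq_sym oner_eq0.
  by rewrite cl mulr0 mul0r.
have atoms l : exists2 q : mpoly n R, (mmeasure (@mdeg n) q <= k.+1)%N
    & forall l', eval q (a l') = (l' == l)%:R.
  (* The factor [c l] compensates the [c l'] of [interp] at [l' = l]; elsewhere the value is 0. *)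
  exists (\sum_j (c l * (Q *m S) j l) *: mpolyX R (basis j)).
    apply: leq_trans (mmeasure_sum _ _ _ _) _; apply/bigmax_leqP => j _.
    by rewrite (leq_trans (mmeasureZ_le _ _ _)) // mmeasureX ltnS basis_deg.
  move=> l'; rewrite /eval raddf_sum /=.
  transitivity (c l / c l' * (l' == l)%:R).
    rewrite -interp mulr_sumr; apply: eq_bigr => j _.
    rewrite mevalZ /eval; field; exact: c0.
  by have [->|] := eqVneq l' l; rewrite ?mulr0 // mulr1 divff.
have a_inj l l' : a l = a l' -> l = l'.
  move=> all'; have [q _ qa] := atoms l; apply/eqP.
  have := qa l'; rewrite -all' qa eqxx => /esym/eqP.
  by rewrite (eq_sym l l'); case: (l' == l); rewrite // eq_sym oner_eq0.
pose T := S^T *m G *m S.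
have PS : P *m S = 1%:M by rewrite mulmxV.
have SP : S *m P = 1%:M by rewrite mulVmx.
(* Self-adjointness makes [T] commute with the diagonal matrix of each coordinate, so a nonzero
   entry forces equal coordinates, hence the same atom. *)
have T0 l l' : l != l' -> T l l' = 0.
  move=> ll'; apply/eqP; apply: contraNT ll' => T0; apply/eqP/a_inj/rowP => i.
  have [X [GX _ PXi]] := PX i; set D := diag_mx _ in PXi.
  have XS : X *m S = S *m D.
    by rewrite -[X]mul1mx -SP -(mulmxA S) PXi -!mulmxA PS mulmx1.
  have : T *m D = D *m T.
    rewrite /T -mulmxA -XS mulmxA -(mulmxA _ G X) GX mulmxA -trmx_mul XS.
    by rewrite trmx_mul tr_diag_mx !mulmxA.
  move: (T) T0 => U U0.
  rewrite mul_mx_diag mul_diag_mx => /matrixP/(_ l l'); rewrite !mxE mulrC.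
  by move/(mulIf U0).
have Tpos l : 0 < T l l.
  rewrite /T gram_entry Gpos //; apply/eqP => /(congr1 (mulmx P)).
  rewrite colE mulmxA PS mul1mx mulmx0 => /colP/(_ l)/eqP.
  by rewrite !mxE !eqxx oner_eq0.
exists a, (fun l => T l l * c l ^+ 2); split=> // [l|al be ald bed].
  by rewrite mulr_gt0 // exprn_even_gt0 //= c0.
rewrite -gram //.
have -> : (v al)^T *m G *m v be = (P *m v al)^T *m T *m (P *m v be).
  rewrite trmx_mul /T !mulmxA -(mulmxA _ P^T) -trmx_mul SP trmx1 mulmx1.
  by rewrite -(mulmxA _ S P) SP mulmx1.
rewrite mxE; apply: eq_bigr => l _; rewrite mxE (bigD1 l) //= big1 ?addr0; last first.
  by move=> l' ll'; rewrite T0 ?mulr0.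
rewrite [_^T ord0 l]mxE (Pv al) // (Pv be) // eval_mpolyXD.
move: (T l l) (c l) (eval _ _) (eval _ _) => t0 c1 x x'; ring.
Qed.

End FlatExtension.

(** * Atoms of a flat truncated moment sequence *)

Lemma mnm_split n (m : multinom n) (j : nat) : (j <= mdeg m)%N ->
  exists al be, [/\ m = mnm_add al be, mdeg al = j & mdeg be = (mdeg m - j)%N].
Proof.
elim: j => [|j IH] jm.
  by exists (@mnm0 n), m; rewrite add0m mdeg0 subn0.
have [al [be [mE al_deg be_deg]]] := IH (ltnW jm).
have [i bei] : exists i, be i != 0%N.
  apply: contrapT => /forallNP h; move: be_deg; rewrite (_ : be = mnm0).
    by rewrite mdeg0 => /esym/eqP; rewrite subn_eq0 leqNgt jm.
  by apply/mnmP => i; rewrite mnm0E; have /negP := h i; rewrite negbK => /eqP.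
exists (mnm_add al (mnm1 i)), (mnm_sub be (mnm1 i)).
have beE : mnm_add (mnm1 i) (mnm_sub be (mnm1 i)) = be by rewrite addmC submK // lep1mP.
split; first by rewrite -addmA beE.
  by rewrite mdegD mdeg1 al_deg addn1.
by move: be_deg; rewrite -beE mdegD mdeg1 beE; lia.
Qed.

Lemma moment_atoms (R : realType) (n d k : nat) (y : mseq R n (2 * d)) :
  psd (moment_mx d y) -> (k <= d)%N -> ('I_n -> (k < d)%N) ->
  \rank (moment_mx k y) = \rank (moment_mx d y) ->
  exists (a : 'I_(\rank (moment_mx d y)) -> 'rV[R]_n)
      (w : 'I_(\rank (moment_mx d y)) -> R),
  [/\ forall l, 0 < w l,
      forall m, (mdeg m <= 2 * d)%N ->
        mom y m = \sum_l w l * eval (mpolyX R m) (a l)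
    & forall l, exists2 q : mpoly n R, (mmeasure (@mdeg n) q <= k.+1)%N
        & forall l', eval q (a l') = (l' == l)%:R].
Proof.
move=> Mpsd kd n_kd rk; have [B [G [MB _ Gpos]]] := psd_factor Mpsd.
(* Monomials are represented by the columns of [B]; the default 0 is taken only above degree [d],
   outside the range of [gram]. *)
pose v m : 'cV[R]_(\rank (moment_mx d y)) :=
  oapp (fun b : bmultinom n d.+1 => col (enum_rank b) B) 0 (insub m).
have gram al be : (mdeg al <= d)%N -> (mdeg be <= d)%N ->
    ((v al)^T *m G *m v be) ord0 ord0 = mom y (mnm_add al be).
  move=> ald bed; rewrite /v (insubT (fun m => (mdeg m < d.+1)%N) ald).
  rewrite (insubT (fun m => (mdeg m < d.+1)%N) bed) /= -gram_entry -MB.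
  by rewrite mxE !enum_rankK.
pose W : 'M[R]_(_, #|{: bmultinom n k.+1}|) :=
  \matrix_(i, j) v (bmnm (enum_val j)) i ord0.
have MW : moment_mx k y = W^T *m G *m W.
  apply/matrixP => i j; rewrite gram_entry mxE -gram.
  - by congr ((_^T *m _ *m _) _ _); apply/colP => l; rewrite !mxE ord1.
  - by rewrite (leq_trans _ kd) // -ltnS bmdeg.
  - by rewrite (leq_trans _ kd) // -ltnS bmdeg.
(* By [MW] the rank of [W] is at least that of the smaller moment matrix, which by flatness is the
   number of rows of [W]. *)
have Wfree : row_free W.
  rewrite /row_free eqn_leq rank_leq_row /= -{1}rk MW.
  exact: mxrankM_maxr.
have [a [w [w0 wm q]]] := flat_atoms Gpos gram kd Wfree n_kd.
exists a, w; split=> // m md.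
(* Cutting at [minn (mdeg m) d] leaves both factors of degree at most [d], the range of [wm]. *)
have [|al [be [mE al_deg be_deg]]] := @mnm_split n m (minn (mdeg m) d).
  exact: geq_minl.
by rewrite mE wm ?al_deg ?be_deg //; lia.
Qed.

Lemma Lfun_atoms (R : realType) (n D s : nat) (y : mseq R n D)
    (a : 'I_s -> 'rV[R]_n) (w : 'I_s -> R) :
  (forall m, (mdeg m <= D)%N -> mom y m = \sum_l w l * eval (mpolyX R m) (a l)) ->
  forall f, (forall m, m \in msupp f -> (mdeg m <= D)%N) ->
  Lfun y f = \sum_l w l * eval f (a l).
Proof.
move=> ya f fD; rewrite /Lfun big_seq.
under eq_bigr => m mf do rewrite ya ?fD // mulr_sumr.
rewrite -big_seq exchange_big /=; apply: eq_bigr => l _.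
rewrite {2}/eval mevalE mulr_sumr; apply: eq_bigr => m _.
by rewrite /eval mevalX mulrCA.
Qed.

Lemma leq_half_deg (R : realType) n (f : mpoly n R) m :
  m \in msupp f -> (mdeg m <= 2 * half_deg f)%N.
Proof.
move=> /(mmeasure_mnm_lt (@mdeg n)); rewrite /half_deg /deg.
case: (mmeasure _ _) => // e; rewrite ltnS => /leq_trans -> //=.
by rewrite mul2n; lia.
Qed.

(** The atoms split the localizing matrix into terms [ev l (ev l)^T] scaled by [w l * g(a l)], and
    the coefficient vector [u] of [q] satisfies [u^T ev l = q(a l)]. *)
Lemma localizing_quadratic (R : realType) (n d s : nat) (y : mseq R n (2 * d))
    (g q : mpoly n R) (a : 'I_s -> 'rV[R]_n) (w : 'I_s -> R) :
  (half_deg g <= d)%N ->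
  (forall m, (mdeg m <= 2 * d)%N -> mom y m = \sum_l w l * eval (mpolyX R m) (a l)) ->
  (mmeasure (@mdeg n) q <= (d - half_deg g).+1)%N ->
  psd (localizing_mx (d - half_deg g) g y) ->
  0 <= \sum_l w l * (eval g (a l) * eval q (a l) ^+ 2).
Proof.
move=> gd ya qd [_ /(_ (\col_j mcoeff (bmnm (enum_val j)) q))].
set u := \col_j _; set e := (d - half_deg g)%N in qd u *.
pose ev l : 'cV[R]_#|{: bmultinom n e.+1}| :=
  \col_j eval (mpolyX R (bmnm (enum_val j))) (a l).
have uev l : (u^T *m ev l) ord0 ord0 = eval q (a l).
  rewrite [in RHS](mpolywE qd) mxE /eval raddf_sum /= [RHS](reindex _ (onW_bij _ (@enum_val_bij _))) /=.
  by apply: eq_bigr => j _; rewrite !mxE /= mevalZ.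
have -> : localizing_mx e g y = \sum_l (w l * eval g (a l)) *: (ev l *m (ev l)^T).
  apply/matrixP => i j; rewrite mxE summxE (Lfun_atoms ya).
    apply: eq_bigr => l _; rewrite !mxE big_ord1 !mxE /eval !mevalM mpolyXD mevalM.
    ring.
  move=> m; rewrite mulrC (perm_mem (msuppMX _ _)) => /mapP[m' m'g ->].
  rewrite !mdegD; have := leq_half_deg m'g.
  have := bmdeg (enum_val i); have := bmdeg (enum_val j); move: gd.
  rewrite /e; clear; move: (mdeg m') (half_deg g) (mdeg _) (mdeg _) => *; lia.
rewrite mulmx_sumr mulmx_suml summxE; congr (0 <= _); apply: eq_bigr => l _.
rewrite -scalemxAr -scalemxAl mxE -mulrA; congr (_ * (_ * _)).
have -> : u^T *m (ev l *m (ev l)^T) *m u = (u^T *m ev l) *m (u^T *m ev l)^T.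
  by rewrite trmx_mul trmxK !mulmxA.
by rewrite mxE big_ord1 [_^T _ _]mxE uev expr2.
Qed.

(** Testing the localizing matrix on the polynomial equal to 1 at atom [l] and 0 at the others
    leaves [w l * g_j(a l) >= 0]. The bound on [k] makes its degree admissible. *)
Lemma atoms_in_semialg (R : realType) (n d k m s : nat) (g : 'I_m -> mpoly n R)
    (y : mseq R n (2 * d)) (a : 'I_s -> 'rV[R]_n) (w : 'I_s -> R) :
  (forall j, (half_deg (g j) + k <= d)%N) ->
  (forall l, 0 < w l) ->
  (forall m, (mdeg m <= 2 * d)%N -> mom y m = \sum_l w l * eval (mpolyX R m) (a l)) ->
  (forall l, exists2 q : mpoly n R, (mmeasure (@mdeg n) q <= k.+1)%N
        & forall l', eval q (a l') = (l' == l)%:R) ->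
  (forall j, psd (localizing_mx (d - half_deg (g j)) (g j) y)) ->
  forall l, semialg g (a l).
Proof.
move=> gkd w0 ya qa psdg l j; have [q qk ql] := qa l.
have gd : (half_deg (g j) <= d)%N by exact: leq_trans (leq_addr _ _) (gkd j).
have qd : (mmeasure (@mdeg n) q <= (d - half_deg (g j)).+1)%N.
  by apply: leq_trans qk _; rewrite ltnS leq_subRL.
have := localizing_quadratic gd ya qd (psdg j).
rewrite (bigD1 l) //= big1 ?addr0 => [|l' ll'].
  by rewrite ql eqxx expr1n mulr1 pmulr_rge0.
by rewrite ql (negPf ll') expr0n !mulr0.
Qed.

(** * Integrals of polynomials *)

Section PolynomialIntegral.
Variables (R : realType) (n : nat).
Implicit Types (f : mpoly n R) (K : set 'rV[R]_n).

Lemma eval_continuous f : continuous (eval f).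
Proof.
move=> x; rewrite /eval.
have -> : (fun y : 'rV[R]_n => meval (fun i => y ord0 i) f) =
    (fun y => \sum_(m <- msupp f) mcoeff m f * \prod_i y ord0 i ^+ m i).
  by apply/funext => y; rewrite mevalE.
apply: (continuous_big (@add_continuous R)) => m _ {}x.
apply: (@continuousM R); first exact: cst_continuous.
apply: (continuous_big (@mul_continuous R)) => i _ {}x.
apply: (@continuous_comp _ _ _ (fun y : 'rV[R]_n => y ord0 i) (@GRing.exp R ^~ (m i))).
  exact: coord_continuous.
exact: exprn_continuous.
Qed.

Lemma eval_measurable f (A : set (borel R n)) :
  measurable_fun A (eval f : borel R n -> R).
Proof.
apply: measurable_funTS; apply: (measurability _ (RGenOpens.measurableE R)).
move=> _ [_ [a [b ->] <-]]; rewrite setTI; apply: sub_sigma_algebra.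
by move/continuousP: (@eval_continuous f); apply; exact: interval_open.
Qed.

Lemma rV_hausdorff : hausdorff_space 'rV[R]_n.
Proof.
move=> x y xy; apply/rowP => i; apply: (@Rhausdorff R) => A B xA yB.
have [z [zA zB]] := xy _ _ (coord_continuous xA) (coord_continuous yB).
by exists (z 0 i).
Qed.

Lemma compact_borel K : compact K -> (measurable (K : set (borel R n))).
Proof.
move=> /(compact_closed rV_hausdorff) Kcl; rewrite -[K]setCK.
by apply: measurableC; apply: sub_sigma_algebra; exact: closed_openC.
Qed.

Definition pint (mu : probability (borel R n) R) K f : R :=
  \int[mu]_(x in K) eval f x.

Variables (mu : probability (borel R n) R) (K : set 'rV[R]_n).
Hypothesis Kc : compact K.

Lemma eval_integrable f : mu.-integrable (K : set (borel R n)) (EFin \o (eval f : borel R n -> R)).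
Proof.
apply: measurable_bounded_integrable.
- exact: compact_borel.
- exact: le_lt_trans (probability_le1 mu (compact_borel Kc)) (ltry 1).
- exact: eval_measurable.
have [M [Mreal KM]] := compact_bounded
  (continuous_compact (continuous_subspaceT (@eval_continuous f)) Kc).
by exists M; split=> // N MN x Kx; apply: KM MN _ _; exists x.
Qed.

Lemma pintE f : (\int[mu]_(x in K) (eval f x)%:E)%E = (pint mu K f)%:E.
Proof.
rewrite /pint /Rintegral fineK //.
by apply: integrable_fin_num; [exact: compact_borel|exact: eval_integrable].
Qed.

Lemma pintD f f' : pint mu K (f + f') = pint mu K f + pint mu K f'.
Proof.
rewrite /pint; under eq_Rintegral do rewrite /eval mevalD.
by apply: RintegralD; [exact: compact_borel|exact: eval_integrable..].
Qed.

Lemma pintZ c f : pint mu K (c *: f) = c * pint mu K f.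
Proof.
rewrite /pint; under eq_Rintegral do rewrite /eval mevalZ.
by apply: RintegralZl; [exact: compact_borel|exact: eval_integrable].
Qed.

Lemma pint_sum I (r : seq I) (c : I -> R) (F : I -> mpoly n R) :
  pint mu K (\sum_(i <- r) c i *: F i) = \sum_(i <- r) c i * pint mu K (F i).
Proof.
elim: r => [|i r IH].
  rewrite !big_nil /pint; under eq_Rintegral do rewrite /eval meval0.
  by rewrite Rintegral_cst ?mul0r //; exact: compact_borel.
by rewrite !big_cons -IH pintD pintZ.
Qed.

Lemma pint_le f f' : (forall x, K x -> eval f x <= eval f' x) ->
  pint mu K f <= pint mu K f'.
Proof.
move=> ff'; apply: le_Rintegral => //.
- exact: compact_borel.
- exact: eval_integrable.
- exact: eval_integrable.
Qed.

Lemma pint_cst c : prob_on K mu -> pint mu K (mpolyC n c) = c.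
Proof.
move=> muK; rewrite /pint; under eq_Rintegral do rewrite /eval mevalC.
rewrite (Rintegral_cst _ (compact_borel Kc)) -[RHS]mulr1; congr (_ * _).
by transitivity (fine (1 : \bar R)) => //; congr fine; exact: muK.
Qed.

End PolynomialIntegral.

(** * Finitely atomic probability measures *)

Section AtomicMeasure.
Variables (R : realType) (n s : nat) (a : 'I_s -> 'rV[R]_n) (w : 'I_s -> R).
Hypotheses (w0 : forall l, 0 <= w l) (w1 : \sum_l w l = 1).

(** [msum] adds measures indexed by [nat], hence the extension from ['I_s]; the defaults lie outside
    the range of summation. *)
Let weight (k : nat) : R := oapp w 0 (insub k).
Let point (k : nat) : borel R n := oapp a 0 (insub k).

Lemma weight_ge0 k : 0 <= weight k.
Proof. by rewrite /weight; case: insubP => [l _ _|] /=. Qed.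

Lemma weightE (l : 'I_s) : weight l = w l.
Proof. by rewrite /weight valK. Qed.

Lemma pointE (l : 'I_s) : point l = a l.
Proof. by rewrite /point valK. Qed.

Let atom (k : nat) : {measure set (borel R n) -> \bar R} :=
  mscale (NngNum (weight_ge0 k)) (dirac (point k)).

Definition atomic : set (borel R n) -> \bar R := msum atom s.

HB.instance Definition _ := measure_function.Measure.on atomic.

Lemma atomicE (A : set (borel R n)) :
  atomic A = (\sum_l (w l)%:E * (\1_A (a l))%:E)%E.
Proof.
rewrite /atomic /msum; apply: eq_bigr => l _.
transitivity ((weight l)%:E * \d_(point l) A)%E => //.
by rewrite weightE pointE.
Qed.

Lemma atomic_setT : atomic setT = 1%E.
Proof.
rewrite atomicE (eq_bigr (fun l => (w l)%:E)) ?sumEFin ?w1 // => l _.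
by rewrite indicT mule1.
Qed.

HB.instance Definition _ := Measure_isProbability.Build _ _ _ atomic atomic_setT.

Definition atomic_probability : probability (borel R n) R := atomic.

Lemma atomic_pint (K : set 'rV[R]_n) (f : mpoly n R) : compact K ->
  (forall l, K (a l)) -> pint atomic_probability K f = \sum_l w l * eval f (a l).
Proof.
move=> Kc Ka; have mK := compact_borel Kc.
have muK : prob_on K atomic_probability.
  rewrite /prob_on /= [LHS]atomicE -[RHS]atomic_setT atomicE.
  apply: eq_bigr => l _; rewrite indicT indicE mem_set //.
have [M [Mreal KM]] := compact_bounded
  (continuous_compact (continuous_subspaceT (@eval_continuous R n f)) Kc).
(* Additivity of the integral in the measure is applied to a nonnegative function, so [f] is raised
   by a constant, which total mass 1 removes at the end. *)
have {KM} [c fc] : exists c, forall x, K x -> 0 <= eval (f + mpolyC n c) x.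
  exists (M + 1) => x Kx; rewrite /eval mevalD mevalC.
  have : `|eval f x| <= M + 1 by apply: KM; [rewrite ltrDl|exists x].
  by rewrite ler_norml /eval => /andP[h _]; lra.
have key : pint atomic_probability K (f + mpolyC n c) =
    \sum_l w l * eval (f + mpolyC n c) (a l).
  set f' := f + _ in fc *; apply: EFin_inj; rewrite -(pintE _ Kc).
  have mf' : measurable_fun (K : set (borel R n))
      (fun x : borel R n => (eval f' x)%:E).
    by apply: measurableT_comp => //; exact: eval_measurable.
  have f'0 x : K x -> (0 <= (eval f' x)%:E)%E by rewrite lee_fin; exact: fc.
  apply: (etrans (ge0_integral_measure_sum atom mK f'0 mf' s)).
  rewrite -sumEFin; apply: eq_bigr => l _.
  rewrite /atom ge0_integral_mscale //.
  rewrite integral_dirac // pointE diracE mem_set ?mul1e //.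
  transitivity ((weight l)%:E * (eval f' (a l))%:E)%E => //.
  by rewrite weightE EFinM.
move: key; rewrite pintD // pint_cst // /eval.
under eq_bigr do rewrite mevalD mevalC mulrDr.
by rewrite big_split /= -mulr_suml w1 mul1r => /addIr.
Qed.

End AtomicMeasure.

Lemma dirac_pint (R : realType) n (K : set 'rV[R]_n) (c : 'rV[R]_n) (f : mpoly n R) :
  compact K -> K c -> pint (@dirac _ (borel R n) c R) K f = eval f c.
Proof.
move=> Kc cK; rewrite /pint /Rintegral integral_dirac.
- by rewrite diracE mem_set // mul1e.
- exact: compact_borel.
- by apply: measurableT_comp => //; exact: eval_measurable.
Qed.

(** * Representing measures of flat sequences *)

(** If every [g j] were constant, the nonempty set would be all of [R^n], on which a coordinate has
    no maximum. This provides the strict inequality [k < d] needed to multiply by a variable. *)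
Lemma semialg_nonconst (R : realType) (n m : nat) (g : 'I_m -> mpoly n R) :
  semialg g !=set0 -> compact (semialg g) -> 'I_n -> (0 < max_half_deg g)%N.
Proof.
move=> [x0 x0K] Kc i; rewrite lt0n; apply/negP => /eqP g0.
have KT x : semialg g x.
  move=> j; have : (half_deg (g j) <= 0)%N.
    by rewrite -g0 /max_half_deg; exact: leq_bigmax.
  move=> gj; have /msize1_polyC gC : (mmeasure (@mdeg n) (g j) <= 1)%N.
    by move: gj; rewrite /half_deg /deg; case: mmeasure => [//|[//|//]].
  by have := x0K j; rewrite gC /eval !mevalC.
have coordc : {within semialg g, continuous (fun y : 'rV[R]_n => y ord0 i)}.
  by apply: continuous_subspaceT; exact: coord_continuous.
have [|c _ cmax] := EVT_max_rV _ Kc coordc; first by exists x0.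
have := cmax (\row__ (c ord0 i + 1)) (mem_set (KT _)).
by rewrite mxE gerDl ler10.
Qed.

(** The weights sum to the moment of degree 0, which is 1; the interpolating polynomials keep the
    atoms distinct, so their number is exactly the rank. *)
Lemma flat_moment_measure (R : realType) (n m d : nat) (g : 'I_m -> mpoly n R)
    (y : mseq R n (2 * d)) :
  semialg g !=set0 -> compact (semialg g) ->
  (forall j, (half_deg (g j) <= d)%N) ->
  psd (moment_mx d y) -> (forall j, psd (localizing_mx (d - half_deg (g j)) (g j) y)) ->
  mom y (@mnm0 n) = 1 ->
  \rank (moment_mx (d - max_half_deg g) y) = \rank (moment_mx d y) ->
  exists mu : probability (borel R n) R,
    [/\ prob_on (semialg g) mu,
        supported_on (semialg g) (\rank (moment_mx d y)) mu
      & forall al, (mdeg al <= 2 * d)%N -> pint mu (semialg g) (mpolyX R al) = mom y al].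
Proof.
move=> Kne Kc gd Mpsd gpsd y1 rk.
have maxd : (max_half_deg g <= d)%N by apply/bigmax_leqP => j _; exact: gd.
have n_kd : 'I_n -> (d - max_half_deg g < d)%N.
  by move=> /(semialg_nonconst Kne Kc) g0; rewrite ltn_subrL g0 (leq_trans g0).
have [a [w [w0 ya qa]]] := moment_atoms Mpsd (leq_subr _ _) n_kd rk.
have aK : forall l, semialg g (a l).
  apply: (atoms_in_semialg _ w0 ya qa gpsd) => j.
  have : (half_deg (g j) <= max_half_deg g)%N by exact: leq_bigmax.
  by move: maxd; lia.
have w_ge0 l : 0 <= w l by exact: ltW.
have w1 : \sum_l w l = 1.
  rewrite -y1 ya ?mdeg0 //; apply: eq_bigr => l _.
  by rewrite /eval mpolyX0 meval1 mulr1.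
have a_inj : injective a.
  move=> l l' all'; have [q _ ql] := qa l; apply/eqP.
  have := ql l'; rewrite -all' ql eqxx => /esym/eqP.
  by rewrite (eq_sym l l'); case: (l' == l); rewrite // eq_sym oner_eq0.
exists (atomic_probability a w_ge0 w1); split.
- rewrite /prob_on /= [LHS]atomicE -[RHS](atomic_setT a w_ge0 w1) atomicE.
  by apply: eq_bigr => l _; rewrite indicT indicE mem_set //; exact: aK.
- exists a; split=> //.
    move=> l; rewrite [X in (_ < X)%E]atomicE (bigD1 l) //= big1 => [|l' ll'].
      by rewrite adde0 indicE mem_set // mule1 lte_fin.
    rewrite indicE memNset ?mule0 //= => /a_inj ll; move: ll'.
    by rewrite ll eqxx.
  rewrite [LHS]atomicE -[RHS](atomic_setT a w_ge0 w1) atomicE.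
  by apply: eq_bigr => l _; rewrite indicT indicE mem_set //; exists l.
- by move=> al ald; rewrite atomic_pint // ya.
Qed.

(** * The game *)

Section Game.
Variables (R : realType) (n1 n2 : nat) (p : mpoly (n1 + n2) R).

(** Extends [p_x] to any function of moments, so that truncated sequences and measures are treated
    alike. *)
Definition integrate_x (M : multinom n1 -> R) : mpoly n2 R :=
  \sum_(m <- msupp p) (mcoeff m p * M (xpart m)) *: mpolyX R (zpart m).

Definition integrate_z (M : multinom n2 -> R) : mpoly n1 R :=
  \sum_(m <- msupp p) (mcoeff m p * M (zpart m)) *: mpolyX R (xpart m).

Lemma eval_row_mx (x : 'rV[R]_n1) (z : 'rV[R]_n2) :
  eval p (row_mx x z) = eval (integrate_z (fun m => eval (mpolyX R m) z)) x.
Proof.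
rewrite {1}/eval mevalE /integrate_z /eval raddf_sum /=; apply: eq_bigr => m _.
rewrite mevalZ !mevalX big_split_ord /= -mulrA [X in _ * X]mulrC; congr (_ * (_ * _)).
  by apply: eq_bigr => i _; rewrite row_mxEr mnmE.
by apply: eq_bigr => i _; rewrite row_mxEl mnmE.
Qed.

Variables (K1 : set 'rV[R]_n1) (K2 : set 'rV[R]_n2).
Hypotheses (K1c : compact K1) (K2c : compact K2).
Variables (mu : probability (borel R n1) R) (nu : probability (borel R n2) R).

Lemma payoff_pint_z :
  payoff p K1 K2 mu nu =
  (pint nu K2 (integrate_x (fun m => pint mu K1 (mpolyX R m))))%:E.
Proof.
rewrite -pintE // /payoff; apply: eq_integral => z _.
under eq_integral do rewrite eval_row_mx.
rewrite pintE // /integrate_z pint_sum // /integrate_x.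
congr (_%:E); rewrite [RHS]raddf_sum /=; apply: eq_bigr => m _.
by rewrite mevalZ mulrAC.
Qed.

(** Fubini is a finite identity here: both sides sum, over the monomials of [p], the coefficient
    times the two moments. *)
Lemma payoff_pint_x :
  payoff p K1 K2 mu nu =
  (pint mu K1 (integrate_z (fun m => pint nu K2 (mpolyX R m))))%:E.
Proof.
rewrite payoff_pint_z /integrate_x /integrate_z !pint_sum //; congr EFin.
by apply: eq_bigr => m _; rewrite mulrAC.
Qed.

End Game.

(** The payoff integrates a fixed polynomial in [z] against [nu]; the Dirac measure at a maximizer
    on [K2] is a best reply. *)
Lemma inner_max_exists (R : realType) (n1 n2 : nat) (p : mpoly (n1 + n2) R)
    (K1 : set 'rV[R]_n1) (K2 : set 'rV[R]_n2) mu :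
  compact K1 -> compact K2 -> K2 !=set0 -> exists v, inner_max p K1 K2 mu v.
Proof.
move=> K1c K2c K2ne; pose f := integrate_x p (fun m => pint mu K1 (mpolyX R m)).
have [c /set_mem cK cmax] := EVT_max_rV K2ne K2c (continuous_subspaceT (@eval_continuous R n2 f)).
exists (eval f c)%:E; split.
  exists (@dirac _ (borel R n2) c R); first by rewrite /prob_on /= diracE mem_set.
  by rewrite payoff_pint_z // dirac_pint.
move=> _ [nu nuK <-]; rewrite payoff_pint_z // lee_fin -[leRHS](pint_cst K2c _ nuK).
by apply: pint_le => // z zK; rewrite /eval mevalC; apply: cmax; rewrite inE.
Qed.

Lemma inner_min_exists (R : realType) (n1 n2 : nat) (p : mpoly (n1 + n2) R)
    (K1 : set 'rV[R]_n1) (K2 : set 'rV[R]_n2) nu :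
  compact K1 -> compact K2 -> K1 !=set0 -> exists v, inner_min p K1 K2 nu v.
Proof.
move=> K1c K2c K1ne; pose f := integrate_z p (fun m => pint nu K2 (mpolyX R m)).
have [c /set_mem cK cmin] := EVT_min_rV K1ne K1c (continuous_subspaceT (@eval_continuous R n1 f)).
exists (eval f c)%:E; split.
  exists (@dirac _ (borel R n1) c R); first by rewrite /prob_on /= diracE mem_set.
  by rewrite payoff_pint_x // dirac_pint.
move=> _ [mu muK <-]; rewrite payoff_pint_x // lee_fin -[leLHS](pint_cst K1c _ muK).
by apply: pint_le => // z zK; rewrite /eval mevalC; apply: cmin; rewrite inE.
Qed.

(** The two bounds meet at the payoff of [mu] and [nu], which is therefore [v]. Any [mu'] concedes
    at least [v] against [nu], and any [nu'] secures at most [v] against [mu]. *)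
Lemma saddle_point (R : realType) (n1 n2 : nat) (p : mpoly (n1 + n2) R)
    (K1 : set 'rV[R]_n1) (K2 : set 'rV[R]_n2) mu nu (v : \bar R) :
  compact K1 -> K1 !=set0 -> compact K2 -> K2 !=set0 ->
  prob_on K1 mu -> prob_on K2 nu ->
  (forall nu', prob_on K2 nu' -> (payoff p K1 K2 mu nu' <= v)%E) ->
  (forall mu', prob_on K1 mu' -> (v <= payoff p K1 K2 mu' nu)%E) ->
  [/\ minmax_value p K1 K2 v, optimal_strategy1 p K1 K2 mu
    & optimal_strategy2 p K1 K2 nu].
Proof.
move=> K1c K1ne K2c K2ne muK nuK mu_le nu_ge.
have vE : payoff p K1 K2 mu nu = v by apply/le_anti; rewrite mu_le // nu_ge.
have mu_max : inner_max p K1 K2 mu v.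
  by split; [exists nu|move=> _ [nu' nu'K <-]; exact: mu_le].
have nu_min : inner_min p K1 K2 nu v.
  by split; [exists mu|move=> _ [mu' mu'K <-]; exact: nu_ge].
have minmax : minmax_value p K1 K2 v.
  split=> [mu' mu'K|]; first exact: inner_max_exists.
  split; first by exists mu.
  move=> u [mu' mu'K [_ u_ub]]; apply: le_trans (nu_ge _ mu'K) _.
  by apply: u_ub; exists nu.
have maxmin : maxmin_value p K1 K2 v.
  split=> [nu' nu'K|]; first exact: inner_min_exists.
  split; first by exists nu.
  move=> u [nu' nu'K [_ u_lb]]; apply: le_trans _ (mu_le _ nu'K).
  by apply: u_lb; exists mu.
by split=> //; split=> //; exists v.
Qed.

(** * Sum-of-squares certificates and bounds on the payoff *)

Lemma quadratic_module_ge0 (R : realType) (n m : nat) (g : 'I_m -> mpoly n R)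
    (sigma : 'I_m.+1 -> mpoly n R) (x : 'rV[R]_n) :
  (forall j, sos (sigma j)) -> semialg g x ->
  0 <= eval (\sum_(j < m.+1) sigma j * with1 g j) x.
Proof.
move=> sossigma xK; rewrite /eval raddf_sum /=; apply: sumr_ge0 => j _.
rewrite mevalM mulr_ge0 //.
  have [s ->] := sossigma j; rewrite raddf_sum /=; apply: sumr_ge0 => q _.
  by rewrite rmorphXn /= sqr_ge0.
by rewrite /with1; case: unliftP => [i _|_]; rewrite ?meval1 //; exact: xK.
Qed.

Lemma mdeg_xpart (R : realType) (n1 n2 : nat) (p : mpoly (n1 + n2) R) m :
  m \in msupp p -> (mdeg (xpart m) <= deg_x p)%N.
Proof. by move=> mp; rewrite /deg_x; exact: (leq_bigmax_seq (F := fun m => mdeg (xpart m)) _ mp). Qed.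

Lemma mdeg_zpart (R : realType) (n1 n2 : nat) (p : mpoly (n1 + n2) R) m :
  m \in msupp p -> (mdeg (zpart m) <= deg_z p)%N.
Proof. by move=> mp; rewrite /deg_z; exact: (leq_bigmax_seq (F := fun m => mdeg (zpart m)) _ mp). Qed.

Theorem theorem5p2 (R : realType) (n1 n2 m1 m2 : nat)
    (g : 'I_m1 -> mpoly n1 R) (h : 'I_m2 -> mpoly n2 R)
    (K1ne : semialg g !=set0) (K1c : compact (semialg g))
    (K2ne : semialg h !=set0) (K2c : compact (semialg h))
    (p : mpoly (n1 + n2) R)
    (d t : nat)
    (d_p : (deg_x p <= 2 * d)%N) (d_g : forall j, (half_deg (g j) <= d)%N)
    (t_p : (deg_z p <= 2 * t)%N) (t_h : forall k, (half_deg (h k) <= t)%N)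
    (lam : R) (y : mseq R n1 (2 * d)) (sigma : 'I_m2.+1 -> mpoly n2 R)
    (optA : optimalA p g h lam y sigma)
    (rkA : \rank (moment_mx (d - max_half_deg g) y) = \rank (moment_mx d y))
    (gam : R) (y' : mseq R n2 (2 * t)) (sigma' : 'I_m1.+1 -> mpoly n1 R)
    (optB : optimalB p g h gam y' sigma')
    (rkB : \rank (moment_mx (t - max_half_deg h) y') = \rank (moment_mx t y'))
    (AB : valueA p g h d = valueB p g h t) :
  [/\ minmax_value p (semialg g) (semialg h) (valueA p g h d),
      minmax_value p (semialg g) (semialg h) (valueB p g h t),
      exists mu : probability (borel R n1) R,
        optimal_strategy1 p (semialg g) (semialg h) mu /\
        supported_on (semialg g) (\rank (moment_mx d y)) mu
    & exists nu : probability (borel R n2) R,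
        optimal_strategy2 p (semialg g) (semialg h) nu /\
        supported_on (semialg h) (\rank (moment_mx t y')) nu].
Proof.
have [[lamE Mpsd gpsd y1 sossig] lamV] := optA.
have [[gamE Mpsd' hpsd y1' sossig'] gamV] := optB.
have [mu [muK mu_supp mu_mom]] := flat_moment_measure K1ne K1c d_g Mpsd gpsd y1 rkA.
have [nu [nuK nu_supp nu_mom]] := flat_moment_measure K2ne K2c t_h Mpsd' hpsd y1' rkB.
(* The certificate makes [lam - p_x p y] nonnegative on [K2]; integrating it against [nu'] bounds
   the payoff. *)
have mu_le nu' : prob_on (semialg h) nu' ->
    (payoff p (semialg g) (semialg h) mu nu' <= lam%:E)%E.
  move=> nu'K; rewrite payoff_pint_z // lee_fin -[leRHS](pint_cst K2c _ nu'K).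
  (* The measure [mu] reproduces [y] up to degree [2 * d], which covers the degree of [p] in [x]. *)
  have -> : integrate_x p (fun m => pint mu (semialg g) (mpolyX R m)) = p_x p y.
    apply: eq_big_seq => m mp; rewrite mu_mom //.
    exact: leq_trans (mdeg_xpart mp) d_p.
  apply: pint_le => // z zK; rewrite -subr_ge0.
  have := quadratic_module_ge0 (fun k => (sossig k).1) zK.
  by rewrite -lamE /eval mevalB.
have nu_ge mu' : prob_on (semialg g) mu' ->
    (lam%:E <= payoff p (semialg g) (semialg h) mu' nu)%E.
  (* Equality of the optimal values replaces [lam] by [gam], the bound certified by the second
     program. *)
  rewrite lamV AB -gamV => mu'K.
  rewrite payoff_pint_x // lee_fin -[leLHS](pint_cst K1c _ mu'K).
  have -> : integrate_z p (fun m => pint nu (semialg h) (mpolyX R m)) = p_z p y'.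
    apply: eq_big_seq => m mp; rewrite nu_mom //.
    exact: leq_trans (mdeg_zpart mp) t_p.
  apply: pint_le => // x xK; rewrite -subr_ge0.
  have := quadratic_module_ge0 (fun k => (sossig' k).1) xK.
  by rewrite -gamE /eval mevalB.
have [minmax opt1 opt2] := saddle_point K1c K1ne K2c K2ne muK nuK mu_le nu_ge.
by split; [rewrite -lamV|rewrite -AB -lamV|exists mu|exists nu].
Qed.
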